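(* For every integer $m\ge2$, the power series \[ \frac{1}{(q;q)_\infty}\big(h(q)-m\,h(q^m)\big)=\sum_{n\ge 0}(C_1(n)-mC_m(n))q^n \] has positive coefficients for all sufficiently large $n$; i.e. there exists $n_0(m)$ such that $C_1(n)>m\,C_m(n)$ for all $n\ge n_0(m)$.
   Context: $(q;q)_\infty=\prod_{j\ge1}(1-q^j)$ and \[ h(q)=\sum_{n=1}^\infty\frac{(-1)^{n+1}q^{n(n+1)/2}}{1-q^n}=\sum_{j=1}^\infty q^{j^2}\big(1+2q^j+2q^{2j}+\cdots+2q^{j^2-j}+q^{j^2}\big). \] For a positive integer $m$, an $m$-string in an ordinary partition is a collection of parts of sizes $m(1+k), m(3+k),\dots,m(2j-1+k)$ for a positive integer $j$ and an integer $0\le k\le j$; its weight is $1$ if $k=0$ or $k=j$, and $2$ otherwise. $C_m(n)$ is the sum, over all partitions $\lambda$ of $n$ and all $m$-strings $\pi$ of $\lambda$, of the weight of $\pi$; one has $\sum_{n\ge1}C_m(n)q^n=h(q^m)/(q;q)_\infty$. *)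

(* Defs.v *)
From mathcomp Require Import all_boot.
Set Implicit Arguments. Unset Strict Implicit. Unset Printing Implicit Defensive.

(* A partition of n is encoded by its multiplicity function:
   f i = number of parts of size i (1 <= i <= n), with f 0 = 0 and
   \sum_i i * f i = n.  This is a bijective encoding of ordinary partitions. *)
Definition mult_fun (n : nat) := {ffun 'I_n.+1 -> 'I_n.+1}.

Definition is_partition (n : nat) (f : mult_fun n) : bool :=
  (nat_of_ord (f ord0) == 0) && (\sum_(i < n.+1) i * f i == n).

Definition has_part (n : nat) (f : mult_fun n) (s : nat) : bool :=
  (0 < s <= n) && (0 < f (inord s)).

Definition mstring_weight (m n : nat) (f : mult_fun n) (j k : nat) : nat :=
  if [&& 1 <= j, k <= j &
        all (fun i => has_part f (m * (2 * i - 1 + k))) (iota 1 j)]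
  then (if (k == 0) || (k == j) then 1 else 2) else 0.

(* C_m(n): sum over partitions of n and over all m-strings of their weights.
   Any m-string (m >= 1) of a partition of n has j <= n and k <= j <= n. *)
Definition C (m n : nat) : nat :=
  \sum_(f : mult_fun n | is_partition f)
    \sum_(j < n.+1) \sum_(k < n.+1) mstring_weight m f j k.

(* Main.v *)
Require Import Defs.
From mathcomp Require Import all_boot.
From mathcomp Require Import all_order all_algebra.
From mathcomp Require Import zify ring lra.
From mathcomp Require Import classical_sets reals topology normedtype derive realfun exp.
From mathcomp Require Import Rstruct.
Set Implicit Arguments. Unset Strict Implicit. Unset Printing Implicit Defensive.
Import Order.TTheory GRing.Theory Num.Theory numFieldNormedType.Exports.

(** A string with parameters (j, k) has total size m (j^2 + j k), so with w the
    weights and p the partition function, C_m(n) is the sum of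
    w(j, k) p(n - m (j^2 + j k)).  Two summations by parts turn this into the
    sum over X of F_m(X) times the second difference of p at n + 1 - X, where
    F_m(X) is the sum of w(j, k) max(0, X - m (j^2 + j k)).

    The second difference of p is nonnegative away from 1, so it is enough to
    bound F_1(X) - m F_m(X) below by a linear function of X with positive
    slope, and to know that p(n) dominates both p(n) - p(n - 1) and n^2.

    For the linear bound, the sum over k is twice a trapezoid rule, exact up to
    an error between 0 and j/4 that occurs only for X/2 < j^2 < X; by
    Euler-Maclaurin, the sum over j of the trapezoid values is
    (ln 2 / 2) X^2 - X/6 + O(sqrt X) for m = 1.  The quadratic terms cancel in
    F_1(X) - m F_m(X) = F_1(X) - m^2 F_1(X / m), and what remains is at least
    (5 m - 8) X / 48 - O(sqrt X).

    For the growth of p, the identity n p(n) = sum of i p(n - i t) over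
    i, t >= 1, differenced twice, shows that the second difference of p is
    o(p), whence so is the first. *)

(** * Partitions with prescribed parts *)

(** Counts the partitions of [t] into parts of size at most [K]; the index [i] is the multiplicity
    of the part [K]. *)
Fixpoint npart (K t : nat) : nat :=
  if K is K'.+1 then \sum_(0 <= i < t.+1 | i * K <= t) npart K' (t - i * K)
  else (t == 0).

Lemma coef_mul_sumXn (Q : {poly nat}) (I : finType) (P : pred I) (e : I -> nat)
    (t : nat) :
  ((Q * \sum_(j | P j) 'X^(e j))`_t = \sum_(j | P j && (e j <= t)%N) Q`_(t - e j))%R.
Proof.
rewrite mulr_sumr coef_sum [RHS]big_mkcondr /=.
by apply: eq_bigr => j _; rewrite coefMXn ltnNge; case: leqP.
Qed.

(** Generating function of the partitions with at least [g i] copies of each [i]: removing these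
    forced copies leaves an arbitrary partition. Truncating the geometric series at [n] does not
    affect coefficients up to [n]. *)
Lemma coef_prod_geom (n : nat) (g : nat -> nat) (K t : nat) : t <= n ->
  ((\prod_(1 <= i < K.+1) \sum_(j < n.+1 | (g i <= j)%N) 'X^(i * j) : {poly nat})`_t
   = if (\sum_(1 <= i < K.+1) i * g i <= t)%N
     then npart K (t - \sum_(1 <= i < K.+1) i * g i)%N else 0)%R.
Proof.
elim: K t => [|K IH] t tn.
  by rewrite !big_nil coef1 /= subn0 natn.
rewrite big_nat_recr //= coef_mul_sumXn [in RHS]big_nat_recr //=.
set S := \sum_(1 <= i < K.+1) i * g i in IH *.
transitivity (\sum_(0 <= j < n.+1 | (g K.+1 <= j) && (S + K.+1 * j <= t))
    npart K (t - (S + K.+1 * j)))%N.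
  rewrite big_mkord [LHS]big_mkcond [RHS]big_mkcond /=; apply: eq_bigr => j _.
  rewrite IH; last by lia.
  case: (leqP (g K.+1) j) => //= gj.
  case: (leqP (K.+1 * j) t) => h.
    have -> : (S + K.+1 * j <= t) = (S <= t - K.+1 * j) by lia.
    by case: ifP => // _; congr npart; lia.
  by case: leqP => //; lia.
rewrite /GRing.add /=.
case: leqP => h; last first.
  rewrite big_nat_cond big1 // => i /andP[_ /andP[gi Si]].
  by nia.
rewrite (big_cat_nat (n := g K.+1)) //=; last by nia.
rewrite big_nat_cond big1 ?add0n; last by move=> i; lia.
rewrite -{1}[g K.+1]add0n big_addn.
rewrite [RHS](big_nat_widen _ _ (n.+1 - g K.+1)); last by nia.
rewrite big_nat_cond [RHS]big_nat_cond.
apply: eq_big => [i|i _]; last by congr npart; nia.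
rewrite -!andbA; case: (i < n.+1 - g K.+1) => //=.
by nia.
Qed.

Lemma card_partition_ge (n : nat) (g : nat -> nat) :
  g 0 = 0 ->
  #|[pred f : mult_fun n | is_partition f && [forall i : 'I_n.+1, g i <= f i]]|
  = if (\sum_(1 <= i < n.+1) i * g i <= n)%N
    then npart n (n - \sum_(1 <= i < n.+1) i * g i)%N else 0.
Proof.
move=> g0; rewrite -(coef_prod_geom _ _ (leqnn n)).
(* [Q] forces multiplicity 0 at the index 0, as [is_partition] does, so that the factor for [i = 0]
   is 1 and the distributed product runs over whole multiplicity functions. *)
pose Q (i j : 'I_n.+1) := (g i <= j) && ((i == ord0) ==> (j == ord0)).
transitivity ((\prod_(i < n.+1) \sum_(j < n.+1 | Q i j) 'X^(i * j) : {poly nat})`_n)%R; last first.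
  rewrite big_ord_recl [X in (X * _)%R](_ : _ = 1%R); last first.
    rewrite (big_pred1 ord0) ?mul0n ?expr0 // => j.
    by rewrite /Q /= g0 leq0n.
  rewrite mul1r big_add1 /= big_mkord.
  congr ((polyseq _)`_n)%R; apply: eq_bigr => i _.
  by apply: eq_bigl => j; rewrite /Q /= andbT.
rewrite bigA_distr_big_dep coef_sum -sum1_card.
rewrite big_mkcond [RHS]big_mkcond /=; apply: eq_bigr => f _.
have -> : (\prod_(i < n.+1) 'X^(i * f i))%R = ('X^(\sum_(i < n.+1) i * f i) : {poly nat})%R.
  by rewrite -(big_morph _ (exprD 'X) (expr0 'X)).
rewrite coefXn.
have -> : (f \in family Q) = [forall i : 'I_n.+1, g i <= f i] && (f ord0 == ord0).
  apply/familyP/andP => [H|[/forallP H /eqP f0] i].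
    split; first by apply/forallP=> i; have /andP[] : Q i (f i) := H i.
    by have /andP[_] : Q ord0 (f ord0) := H ord0.
  suff: Q i (f i) by [].
  by rewrite /Q H /=; apply/implyP => /eqP ->; rewrite f0.
rewrite !inE /is_partition [n == _]eq_sym -[f ord0 == ord0]/(nat_of_ord (f ord0) == 0).
have [_|_] := boolP [forall i : 'I_n.+1, g i <= f i]; rewrite ?andbF //=.
by rewrite andbT; case: (_ == 0) => //; case: (_ == n).
Qed.

(** Either the part [K.+1] is absent, or one copy of it can be removed. *)
Lemma npartS (K t : nat) :
  npart K.+1 t = npart K t + (if K < t then npart K.+1 (t - K.+1) else 0).
Proof.
rewrite [LHS]/= big_ltn_cond // mul0n leq0n subn0 big_add1 /=; congr addn.
case: ltnP => h; last first.
  by rewrite big_nat_cond big1 // => i /andP[_]; lia.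
rewrite [RHS](big_nat_widen _ _ t); last by lia.
apply: eq_big => [i|i _]; last by congr npart; lia.
by nia.
Qed.

Lemma npart_stable (K t : nat) : t <= K -> npart K t = npart t t.
Proof.
elim: K => [|K IH]; first by case: t.
rewrite leq_eqVlt => /orP[/eqP -> //|]; rewrite ltnS => tK.
by rewrite npartS ltnNge tK addn0 IH.
Qed.

Definition string_weight (j k : nat) : nat :=
  if (1 <= j) && (k <= j) then (if (k == 0) || (k == j) then 1 else 2) else 0.

Lemma sum_indicator (s : seq nat) (n : nat) : uniq s -> all (fun x => 0 < x <= n) s ->
  \sum_(1 <= i < n.+1) i * (i \in s) = \sum_(i <- s) i.
Proof.
move=> us /allP sn.
have ps : perm_eq s [seq i <- index_iota 1 n.+1 | i \in s].
  apply: uniq_perm => //; first by rewrite filter_uniq // iota_uniq.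
  move=> x; rewrite mem_filter mem_index_iota.
  by case xs: (x \in s) => //=; have := sn _ xs; lia.
rewrite (perm_big _ ps) /= big_filter big_mkcond /= [RHS]big_mkcond /=.
by rewrite -big_mkcond [RHS]big_mkcond /=; apply: eq_bigr => i _; case: ifP => _; lia.
Qed.

Lemma sum_string (m j k : nat) :
  \sum_(i <- iota 1 j) m * (2 * i - 1 + k) = m * (j ^ 2 + j * k).
Proof.
elim: j => [|j IH]; first by rewrite big_nil; lia.
by rewrite -[in LHS](addn1 j) iotaD big_cat /= big_seq1 IH; nia.
Qed.

(** The parts of a string are distinct, so containing it means having multiplicities at least its
    indicator function; removing the string leaves a partition of the remainder. *)
Lemma sum_mstring_weight (m n j k : nat) : 0 < m ->
  \sum_(f : mult_fun n | is_partition f) mstring_weight m f j k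
  = string_weight j k *
    (if m * (j ^ 2 + j * k) <= n then npart n (n - m * (j ^ 2 + j * k)) else 0).
Proof.
move=> m0; rewrite /mstring_weight /string_weight.
have [jk|] := boolP ((1 <= j) && (k <= j)); last first.
  by move=> h; rewrite big1 // => f _; rewrite andbA (negbTE h).
set w := if _ || _ then 1 else 2.
pose s := [seq m * (2 * i - 1 + k) | i <- iota 1 j].
have us : uniq s.
  by rewrite map_inj_in_uniq ?iota_uniq // => x y; rewrite !mem_iota; nia.
have ss : \sum_(i <- s) i = m * (j ^ 2 + j * k) by rewrite big_map sum_string.
under eq_bigr => f _ do rewrite andbA jk /=.
rewrite -big_mkcondr /= sum_nat_const mulnC; congr muln.
have [sn|] := boolP (all (fun x => 0 < x <= n) s).
  rewrite -ss -(sum_indicator us sn).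
  rewrite -(@card_partition_ge n (fun i => i \in s)); last first.
    by case: (boolP (0 \in s)) => // /(allP sn).
  apply: eq_card => f; rewrite !inE; congr andb.
  apply/allP/forallP => [H i|H i iI].
    case: (boolP ((i : nat) \in s)) => // /mapP[x xI ix].
    by have := H x xI; rewrite /has_part -ix inord_val => /andP[_].
  have xs : m * (2 * i - 1 + k) \in s by apply/mapP; exists i.
  have xn := allP sn _ xs; rewrite /has_part xn /=.
  by have := H (inord (m * (2 * i - 1 + k))); rewrite inordK ?xs //; lia.
(* Some part [x] of the string exceeds [n]: then so does the total size, and no partition of [n]
   contains the string. Both sides vanish. *)
rewrite -has_predC => /hasP[x xs /= xn].
rewrite ifF; last first.
  apply/negbTE; rewrite -ltnNge -ss (big_rem x) //=.
  by case/mapP: xs xn => y; rewrite mem_iota; nia.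
apply: eq_card0 => f; rewrite !inE.
apply/negbTE/nandP; right; rewrite -has_predC; apply/hasP.
by case/mapP: xs xn => y yI -> xn; exists y => //=; rewrite /has_part negb_and xn.
Qed.

Lemma C_npart (m n : nat) : 0 < m ->
  C m n = \sum_(j < n.+1) \sum_(k < n.+1) string_weight j k *
    (if m * (j ^ 2 + j * k) <= n then npart n (n - m * (j ^ 2 + j * k)) else 0).
Proof.
move=> m0; rewrite /C exchange_big /=; apply: eq_bigr => j _.
rewrite exchange_big /=; apply: eq_bigr => k _.
exact: sum_mstring_weight.
Qed.

Local Open Scope ring_scope.

(** * Differences of the partition function *)

(** Extended by 0 to negative integers, so that recurrences and shifts hold without side
    conditions. *)
Definition zpart (K : nat) (z : int) : int :=
  if z is Posz t then (npart K t)%:Z else 0.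

Definition part (z : int) : int := zpart `|z|%N z.
Definition dpart (z : int) : int := part z - part (z - 1).
Definition ddpart (z : int) : int := dpart z - dpart (z - 1).

Lemma zpart_neg (K : nat) (z : int) : z < 0 -> zpart K z = 0.
Proof. by case: z. Qed.

Lemma zpart_ge0 (K : nat) (z : int) : 0 <= zpart K z.
Proof. by case: z. Qed.

Lemma zpartS (K : nat) (z : int) :
  zpart K.+1 z = zpart K z + zpart K.+1 (z - K.+1%:Z).
Proof.
case: z => [t|t]; last by rewrite [X in _ + X]zpart_neg //; lia.
rewrite {1}/zpart npartS PoszD; congr (_ + _).
case: ltnP => h; last by rewrite zpart_neg //; lia.
by rewrite subzn.
Qed.

Lemma zpart_part (K : nat) (z : int) : z <= K%:Z -> zpart K z = part z.
Proof. by case: z => // t tK; rewrite /part /= npart_stable. Qed.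

(* the number of partitions of [z] into parts from [2] to [K], for [1 <= K] *)
Definition zpart2 (K : nat) (z : int) : int := zpart K z - zpart K (z - 1).

Lemma zpart2S (K : nat) (z : int) :
  zpart2 K.+1 z = zpart2 K z + zpart2 K.+1 (z - K.+1%:Z).
Proof.
rewrite /zpart2 zpartS [zpart K.+1 (z - 1)]zpartS.
rewrite (_ : z - 1 - K.+1%:Z = z - K.+1%:Z - 1); [ring|lia].
Qed.

Lemma zpart2_1 (z : int) : zpart2 1 z = (z == 0)%R%:Z.
Proof.
have H (t : int) : zpart 1 t = (0 <= t)%R%:Z.
  case: t => // n; elim: n => [|n IH]; first by rewrite zpartS [X in _ + X]zpart_neg.
  rewrite zpartS (_ : n.+1%:Z - 1 = n%:Z) ?IH; last by lia.
  by [].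
by rewrite /zpart2 !H; case: (ltrgt0P z) => h; case: (lerP 0 (z - 1)) => h1 //=; lia.
Qed.

Lemma zpart2_ge0 (K : nat) (z : int) : 0 <= zpart2 K.+1 z.
Proof.
elim: K z => [|K IH] z; first by rewrite zpart2_1.
suff H n : forall z, z < n%:Z -> 0 <= zpart2 K.+2 z by apply: (H `|z|.+1); lia.
elim: n => [|n IHn] {}z zn; first by rewrite /zpart2 !zpart_neg //; lia.
by rewrite zpart2S addr_ge0 // IHn; lia.
Qed.

(** [dpart z] counts the partitions of [z] without ones; they are sorted by their largest part
    [K.+1], the empty partition giving the first term. *)
Lemma dpart_sum (N : nat) (z : int) : z <= N.+1%:Z ->
  dpart z = (z == 0)%R%:Z + \sum_(1 <= K < N.+1) zpart2 K.+1 (z - K.+1%:Z).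
Proof.
move=> zN; rewrite /dpart -!(@zpart_part N.+1) -/(zpart2 N.+1 z); try lia.
elim: N {zN} => [|N IH]; first by rewrite big_nil addr0 zpart2_1.
by rewrite big_nat_recr //= addrA -IH zpart2S.
Qed.

(* Enlarging the largest part by one turns a partition of [n - 1] without ones
   into a partition of [n] without ones. *)
Lemma ddpart_ge0 (z : int) : z != 1 -> 0 <= ddpart z.
Proof.
move=> z1; rewrite /ddpart.
(* The two ranges differ by one so that, once the term of largest part 2 is split off, largest part
   [K.+2] for [z] is matched with [K.+1] for [z - 1]. *)
rewrite (@dpart_sum `|z|.+1) ?(@dpart_sum `|z| (z - 1)); try lia.
rewrite big_ltn // [X in _ + (_ + X)]big_add1 /=.
rewrite (_ : z - 1 == 0 = false) ?add0r; last by lia.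
rewrite -2!addrA addr_ge0 //; apply: addr_ge0; first exact: zpart2_ge0.
rewrite -sumrB.
apply: sumr_ge0 => K _.
rewrite (_ : z - 1 - K.+1%:Z = z - K.+2%:Z); last by lia.
rewrite [zpart2 K.+2 _]zpart2S addrAC subrr add0r; exact: zpart2_ge0.
Qed.

Lemma part_neg (z : int) : z < 0 -> part z = 0.
Proof. exact: zpart_neg. Qed.

Lemma sum_ddpart (N : nat) (z : int) :
  \sum_(0 <= M < N) ddpart (z - M%:Z) = dpart z - dpart (z - N%:Z).
Proof.
elim: N => [|N IH]; first by rewrite big_nil subr0 subrr.
rewrite big_nat_recr //= IH /ddpart (_ : z - N%:Z - 1 = z - N.+1%:Z); [ring|lia].
Qed.

Lemma sum_weight_ddpart (N : nat) (z : int) :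
  \sum_(0 <= M < N) M.+1%:Z * ddpart (z - M%:Z)
  = part z - N.+1%:Z * part (z - N%:Z) + N%:Z * part (z - N.+1%:Z).
Proof.
elim: N => [|N IH]; first by rewrite big_nil subr0; ring.
rewrite big_nat_recr //= IH /ddpart /dpart.
rewrite (_ : z - N%:Z - 1 = z - N.+1%:Z); last by lia.
rewrite (_ : z - N.+1%:Z - 1 = z - N.+2%:Z); last by lia.
rewrite !(intS N.+1) !(intS N); ring.
Qed.

Lemma part_ddpart (N : nat) (z : int) : z < N%:Z ->
  part z = \sum_(0 <= M < N) M.+1%:Z * ddpart (z - M%:Z).
Proof.
by move=> zN; rewrite sum_weight_ddpart !(@part_neg (_ - _)); try lia; ring.
Qed.

(** The truncated difference [M.+1 - s] plays the role of max(0, X - s) with X = [M.+1]; all shifts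
    thus use the same values of [ddpart]. *)
Lemma part_ddpart_shift (N s : nat) (z : int) : z < N%:Z ->
  part (z - s%:Z) = \sum_(0 <= M < N) (M.+1 - s)%N%:Z * ddpart (z - M%:Z).
Proof.
move=> zN; case: (leqP s N) => sN; last first.
  rewrite part_neg ?big1_seq //; last by lia.
  move=> M; rewrite mem_index_iota => /andP[_ MN].
  by rewrite (_ : (M.+1 - s)%N = 0%N) ?mul0r //; lia.
rewrite (@part_ddpart (N - s)%N); last by lia.
rewrite [RHS](big_cat_nat (n := s)) //= [X in _ = X + _]big1_seq ?add0r; last first.
  move=> M; rewrite mem_index_iota => /andP[_ MN].
  by rewrite (_ : (M.+1 - s)%N = 0%N) ?mul0r //; lia.
have -> (F : nat -> int) : \sum_(s <= i < N) F i = \sum_(0 <= i < N - s) F (i + s)%N.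
  by rewrite -{1}[s]add0n big_addn.
by apply: eq_bigr => M _; congr (_ * ddpart _); lia.
Qed.

(** * Growth of the partition function *)

Lemma sum_leq_nat (n a : nat) : (a <= n)%N ->
  (\sum_(1 <= t < n.+1) (t <= a))%N = a.
Proof.
move=> an; rewrite (big_cat_nat (n := a.+1)) //=.
rewrite [X in (_ + X)%N]big1_seq ?addn0; last first.
  by move=> t; rewrite mem_index_iota => /andP[_ h]; rewrite leqNgt; case: leqP; lia.
rewrite (@eq_big_nat _ _ _ 1 a.+1 _ (fun=> 1%N)); first by rewrite sum_nat_const_nat; lia.
by move=> t /andP[_]; rewrite ltnS => ->.
Qed.

(** Double count of the total size of all partitions of [n]: [f i] is the number of [t >= 1] with
    [t <= f i], and the partitions with at least [t] copies of [i] correspond to the partitions of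
    [n - i * t]. *)
Lemma npart_sum_sizes (n : nat) :
  (n * npart n n = \sum_(1 <= i < n.+1) \sum_(1 <= t < n.+1)
     i * (if i * t <= n then npart n (n - i * t) else 0))%N.
Proof.
transitivity (\sum_(f : mult_fun n | is_partition f) \sum_(i < n.+1) i * f i)%N.
  rewrite (eq_bigr (fun=> n)); last by move=> f /andP[_ /eqP].
  have := @card_partition_ge n (fun=> 0%N) erefl.
  rewrite big1 => [|i _]; last by rewrite muln0.
  rewrite subn0 leq0n => <-; rewrite sum_nat_const mulnC; congr muln.
  apply: eq_card => f; rewrite !inE (_ : [forall i : 'I_n.+1, 0 <= f i]%N = true) ?andbT //.
  exact/forallP.
rewrite exchange_big big_ord_recl /= big1 ?add0n; last by move=> f _; rewrite mul0n.
rewrite [RHS]big_add1 /= big_mkord; apply: eq_bigr => i _.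
under eq_bigr => f _.
  have -> : (lift ord0 i * f (lift ord0 i))%N
      = (\sum_(1 <= t < n.+1) lift ord0 i * (t <= f (lift ord0 i)))%N.
    by rewrite -big_distrr /= sum_leq_nat // -ltnS.
  over.
rewrite exchange_big /=; rewrite big_nat_cond [RHS]big_nat_cond.
apply: eq_bigr => t /andP[/andP[t0 tn] _].
rewrite -big_distrr /=; congr muln.
pose g x : nat := if x == bump 0 i then t else 0.
have gS : (\sum_(1 <= x < n.+1) x * g x = i.+1 * t)%N.
  rewrite (big_rem (i.+1)) ?mem_index_iota; last by rewrite /=; have := ltn_ord i; lia.
  rewrite /= /g eqxx big1_seq ?addn0 // => x /andP[_].
  by rewrite mem_rem_uniq ?iota_uniq // !inE => /andP[/negbTE]; rewrite /bump /= add1n => ->; rewrite muln0.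
rewrite -gS -card_partition_ge // -sum1_card [LHS]big_mkcond [RHS]big_mkcond /=.
apply: eq_bigr => f _; rewrite inE.
have -> : [forall x : 'I_n.+1, g x <= f x]%N = (t <= f (lift ord0 i))%N.
  apply/forallP/idP => [/(_ (lift ord0 i))|h x]; first by rewrite /g /= eqxx.
  rewrite /g; case: eqP => // e; suff -> : x = lift ord0 i by [].
  exact: val_inj.
by case: is_partition; case: (t <= _)%N.
Qed.

Lemma part_nat (n k : nat) : (k <= n)%N -> part k%:Z = (npart n k)%:Z.
Proof. by move=> kn; rewrite -(@zpart_part n). Qed.

Lemma part_sum_sizes (N : nat) (z : int) : z <= N%:Z ->
  z * part z = \sum_(1 <= i < N.+1) \sum_(1 <= t < N.+1) i%:Z * part (z - (i * t)%N%:Z).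
Proof.
case: z => [n|n] zN; last first.
  rewrite part_neg // mulr0 big1 // => i _; rewrite big1 // => t _.
  by rewrite part_neg ?mulr0 //; lia.
have nN : (n <= N)%N by lia.
rewrite (big_cat_nat (n := n.+1)) //= [X in _ = _ + X]big1_seq ?addr0; last first.
  move=> i; rewrite mem_index_iota => /andP[_ iN]; rewrite big1_seq // => t.
  by rewrite mem_index_iota => tN; rewrite part_neg ?mulr0 //; nia.
rewrite -PoszM npart_sum_sizes.
rewrite (big_morph Posz PoszD (erefl 0%:Z)) /=; rewrite big_nat_cond [RHS]big_nat_cond.
apply: eq_bigr => i /andP[/andP[i0 iN] _].
rewrite (big_morph Posz PoszD (erefl 0%:Z)) /=.
rewrite [RHS](big_cat_nat (n := n.+1)) //= [X in _ = _ + X]big1_seq ?addr0; last first.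
  move=> t; rewrite mem_index_iota => /andP[_ tN].
  by rewrite part_neg ?mulr0 //; nia.
apply: eq_bigr => t _; rewrite PoszM; congr (_ * _).
case: leqP => h; last by rewrite part_neg //; lia.
by rewrite subzn // (@part_nat n) // leq_subr.
Qed.

Lemma ddpart_sum_sizes (N : nat) (z : int) : z <= N%:Z ->
  z * ddpart z + 2 * dpart (z - 1)
  = \sum_(1 <= i < N.+1) \sum_(1 <= t < N.+1) i%:Z * ddpart (z - (i * t)%N%:Z).
Proof.
move=> zN.
(* Discrete Leibniz rule for the second difference of [z * part z]. *)
have <- : z * part z - 2 * ((z - 1) * part (z - 1)) + (z - 2) * part (z - 2)
    = z * ddpart z + 2 * dpart (z - 1).
  rewrite /ddpart /dpart (_ : z - 1 - 1 = z - 2); [ring|lia].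
rewrite !(@part_sum_sizes N); try lia.
rewrite mulr_sumr -sumrB -big_split /=; apply: eq_bigr => i _.
rewrite mulr_sumr -sumrB -big_split /=; apply: eq_bigr => t _.
rewrite /ddpart /dpart.
set w := (i * t)%N%:Z.
rewrite (_ : z - 1 - w = z - w - 1); last by lia.
rewrite (_ : z - 2 - w = z - w - 1 - 1); [ring|lia].
Qed.

Lemma sum_multiples_le (V : nat -> int) (n t : nat) : (0 < t)%N ->
  (forall M, 0 <= V M) -> (forall M, (n < M)%N -> V M = 0) ->
  \sum_(1 <= i < n.+1) V (i * t)%N <= \sum_(0 <= M < n.+1) V M.
Proof.
move=> t0 V0 Vn.
have H k : \sum_(1 <= i < k.+1) V (i * t)%N <= \sum_(0 <= M < (k * t).+1) V M.
  elim: k => [|k IH]; first by rewrite big_nil sumr_ge0.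
  rewrite big_nat_recr //= [leRHS]big_nat_recr //= lerD2r (le_trans IH) //.
  rewrite [leRHS](big_cat_nat (n := (k * t).+1)) //=; last by nia.
  by rewrite lerDl sumr_ge0.
apply: le_trans (H n) _.
rewrite (big_cat_nat (n := n.+1)) //=; last by nia.
rewrite [X in _ + X]big1_seq ?addr0 // => M.
by rewrite mem_index_iota => /andP[_ /andP[/Vn]].
Qed.

(* Split at [t <= B]: there [i <= i * t]; beyond it [B * i <= i * t]. *)
Lemma sum_sizes_le (V : nat -> int) (n B : nat) :
  (forall M, 0 <= V M) -> (forall M, (n < M)%N -> V M = 0) -> (B <= n)%N ->
  B%:Z * (\sum_(1 <= i < n.+1) \sum_(1 <= t < n.+1) i%:Z * V (i * t)%N)
  <= (B * B + n)%N%:Z * \sum_(0 <= M < n.+1) M%:Z * V M.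
Proof.
move=> V0 Vn Bn; set S := \sum_(0 <= M < _) _.
have S0 : 0 <= S by rewrite sumr_ge0 // => M _; rewrite mulr_ge0.
pose w M := M%:Z * V M.
have w0 M : 0 <= w M by rewrite mulr_ge0.
have wn M : (n < M)%N -> w M = 0 by move=> h; rewrite /w Vn ?mulr0.
have H1 t : (0 < t)%N -> \sum_(1 <= i < n.+1) w (i * t)%N <= S.
  by move=> t0; exact: sum_multiples_le.
have H2 i : (0 < i)%N -> \sum_(1 <= t < n.+1) w (i * t)%N <= S.
  by move=> i0; under eq_bigr do rewrite mulnC; exact: H1.
rewrite PoszD mulrDl PoszM -mulrA.
apply: (@le_trans _ _ (B%:Z * (\sum_(1 <= t < n.+1 | (t <= B)%N)
   \sum_(1 <= i < n.+1) w (i * t)%N)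
   + \sum_(1 <= i < n.+1) \sum_(1 <= t < n.+1) w (i * t)%N)).
  rewrite [X in _ <= _ * X + _](exchange_big_dep xpredT) //=.
  rewrite !mulr_sumr -big_split /=; apply: ler_sum => i _.
  rewrite !mulr_sumr [X in _ <= X + _]big_mkcond -big_split /=; apply: ler_sum_nat => t t1.
  rewrite /w; have := V0 (i * t)%N; move: (V _) => x x0.
  rewrite andbT; case: leqP => h; nia.
(* Each inner sum runs over multiples of a fixed number, hence is at most [S]. The [B] values of
   [t], with the factor [B], give [B * B]; the [n] values of [i] in the second sum give [n]. *)
apply: lerD.
  rewrite ler_wpM2l //.
  rewrite -(big_nat_widen 1 B.+1 n.+1 xpredT _ (_ : (B.+1 <= n.+1)%N)) //.
  apply: (@le_trans _ _ (\sum_(1 <= t < B.+1) S)).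
    by apply: ler_sum_nat => t /andP[t0 _]; exact: H1.
  by rewrite sumr_const_nat subn1 /= -mulr_natl natz.
apply: (@le_trans _ _ (\sum_(1 <= t < n.+1) S)).
  by apply: ler_sum_nat => t /andP[t0 _]; exact: H2.
by rewrite sumr_const_nat subn1 /= -mulr_natl natz.
Qed.

Lemma dpart_ge0 (z : int) : 0 <= dpart z.
Proof.
rewrite (@dpart_sum `|z|) ?addr_ge0 //; last by lia.
by apply: sumr_ge0 => K _; exact: zpart2_ge0.
Qed.

Lemma part_homo (y z : int) : y <= z -> part y <= part z.
Proof.
suff H (k : nat) x : part x <= part (x + k%:Z).
  by move=> yz; have -> : z = y + `|z - y|%N%:Z; [lia|exact: H].
elim: k => [|k IH]; first by rewrite addr0.
apply: le_trans IH _; have := dpart_ge0 (x + k.+1%:Z).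
by rewrite /dpart subr_ge0 (_ : x + k.+1%:Z - 1 = x + k%:Z) //; lia.
Qed.

Lemma part_small : [/\ part 0 = 1, part 1 = 1 & part 2 = 2].
Proof.
have z0 K : npart K 0 = 1%N by rewrite npart_stable.
have z1 K : npart K.+1 1 = 1%N by rewrite npart_stable // npartS subnn z0.
have z2 : npart 2 2 = 2%N by rewrite npartS (npartS 0) subnn (_ : (2 - 1 = 1)%N) // z0 z1.
split; [exact: (congr1 Posz (z0 0%N))|exact: (congr1 Posz (z1 0%N))|exact: (congr1 Posz z2)].
Qed.

(** The value at 1 is the only negative second difference, and has to be treated apart below. *)
Lemma ddpart_small : [/\ ddpart 0 = 1, ddpart 1 = -1 & ddpart 2 = 1].
Proof.
have [p0 p1 p2] := part_small.
have m1 : part (- 1) = 0 by rewrite part_neg.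
have m2 : part (- 2) = 0 by rewrite part_neg.
split.
- by change (part 0 - part (- 1) - (part (- 1) - part (- 2)) = 1); rewrite p0 m1 m2.
- by change (part 1 - part 0 - (part 0 - part (- 1)) = - 1); rewrite p0 p1 m1.
- by change (part 2 - part 1 - (part 1 - part 0) = 1); rewrite p0 p1 p2.
Qed.

Lemma part_ge_id (n : nat) : n%:Z <= part n%:Z.
Proof.
have [p0 p1 p2] := part_small.
have H k : 1 <= dpart k.+2%:Z.
  elim: k => [|k IH]; first by rewrite /dpart p2 (_ : 2 - 1 = 1) // p1.
  apply: le_trans IH _; rewrite -subr_ge0.
  rewrite (_ : k.+2%:Z = k.+3%:Z - 1); last by lia.
  exact: ddpart_ge0.
case: n => [|n]; first by rewrite p0.
elim: n => [|n IH]; first by rewrite p1.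
have := H n; rewrite /dpart (_ : n.+2%:Z - 1 = n.+1%:Z); lia.
Qed.

(** By the differenced size identity, [n * ddpart n] is at most a double sum that [sum_sizes_le]
    bounds by [(B * B + n) / B] times about [part n]; and [B * B + n <= 2 * n]. *)
Lemma ddpart_le (n B : nat) : (B * B <= n)%N -> (0 < n)%N ->
  B%:Z * ddpart n%:Z <= 4 * part n%:Z.
Proof.
move=> Bn n0.
(* The negative value [ddpart 1], met at [M = n.-1], is raised to 0 to make [V] nonnegative; this
   costs the [n.-1] in [SV]. *)
pose V M := if (M == n.-1)%N then 0 else ddpart (n%:Z - M%:Z).
have V0 M : 0 <= V M.
  by rewrite /V; case: eqP => // h; apply: ddpart_ge0; lia.
have ddV M : ddpart (n%:Z - M%:Z) <= V M.
  rewrite /V; case: eqP => // ->; rewrite (_ : _ - _ = 1); last by lia.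
  by have [_ -> _] := ddpart_small.
have Vn M : (n < M)%N -> V M = 0.
  move=> nM; rewrite /V; case: eqP => // _.
  by rewrite /ddpart /dpart !part_neg //; lia.
have := @sum_sizes_le V n B V0 Vn; rewrite (_ : (B <= n)%N); last by nia.
move=> /(_ isT) H.
have SV : \sum_(0 <= M < n.+1) M%:Z * V M = part (n%:Z - 1) + n.-1%:Z.
  have -> : part (n%:Z - 1) = \sum_(0 <= M < n.+1) M%:Z * ddpart (n%:Z - M%:Z).
    have := @part_ddpart n.+1 n%:Z (ltac:(lia)).
    have := @sum_ddpart n.+1 n%:Z.
    rewrite (_ : n%:Z - n.+1%:Z = -1); last by lia.
    rewrite /dpart !(@part_neg (-1)) ?(@part_neg (-1 - 1)) // !subr0.
    move=> e1 e2.
    have : \sum_(0 <= M < n.+1) (M.+1%:Z * ddpart (n%:Z - M%:Z) - ddpart (n%:Z - M%:Z))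
        = \sum_(0 <= M < n.+1) M%:Z * ddpart (n%:Z - M%:Z).
      by apply: eq_bigr => M _; rewrite intS; ring.
    by rewrite sumrB e1 -e2 => <-; ring.
  rewrite (bigD1_seq n.-1) ?iota_uniq ?mem_index_iota; [|lia|by []].
  rewrite [in RHS](bigD1_seq n.-1) ?iota_uniq ?mem_index_iota /=; [|lia|by []].
  rewrite {1}/V eqxx mulr0 add0r (_ : n%:Z - n.-1%:Z = 1); last by lia.
  have [_ -> _] := ddpart_small.
  rewrite mulrN1 addrAC addNr add0r; apply: eq_bigr => M /negbTE h.
  by rewrite /V h.
have S2 : part (n%:Z - 1) + n.-1%:Z <= 2 * part n%:Z.
  have := part_ge_id n.-1; rewrite (_ : n.-1%:Z = n%:Z - 1); last by lia.
  have := @part_homo (n%:Z - 1) n%:Z (ltac:(lia)); lia.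
have H2 : n%:Z * ddpart n%:Z <= \sum_(1 <= i < n.+1) \sum_(1 <= t < n.+1) i%:Z * V (i * t)%N.
  apply: (@le_trans _ _ (n%:Z * ddpart n%:Z + 2 * dpart (n%:Z - 1))).
    by rewrite lerDl mulr_ge0 // dpart_ge0.
  rewrite (@ddpart_sum_sizes n) //; apply: ler_sum => i _; apply: ler_sum => t _.
  by rewrite ler_wpM2l.
have P0 : 0 <= part n%:Z by apply: le_trans (part_ge_id n).
have n0' : 0 < n%:Z by [].
rewrite -(ler_pM2l n0').
apply: (@le_trans _ _ ((B * B + n)%N%:Z * (2 * part n%:Z))).
  rewrite mulrCA; apply: le_trans (ler_wpM2l _ H2) _ => //.
  by apply: le_trans H _; rewrite SV ler_wpM2l.
by nia.
Qed.

(** Since [ddpart] is small, [dpart] hardly drops over the [h] arguments up to [n], so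
    [part n - part (n - h)] is nearly at least [h * dpart n]. *)
Lemma dpart_small_o (h : nat) : (0 < h)%N ->
  exists n0 : nat, forall n : nat, (n0 <= n)%N -> h%:Z * dpart n%:Z <= 2 * part n%:Z.
Proof.
(* With this [B] the accumulated error [h * h * 4 * part n / B] is just [part n]; the threshold
   keeps [n - j >= B * B] for [j <= h]. *)
move=> h0; pose B := (4 * h * h)%N; exists (h + B * B).+1 => n nB.
have P0 : 0 <= part n%:Z by apply: le_trans (part_ge_id n).
have E (j : nat) : (j <= h)%N -> B%:Z * (dpart n%:Z - dpart (n%:Z - j%:Z)) <= j%:Z * (4 * part n%:Z).
  elim: j => [|j IH] jh; first by rewrite subr0 subrr mulr0 mul0r.
  have {}IH := IH (ltnW jh).
  have := @ddpart_le (n - j) B (ltac:(lia)) (ltac:(lia)).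
  rewrite -subzn; last by lia.
  have := @part_homo (n%:Z - j%:Z) n%:Z (ltac:(lia)).
  rewrite /ddpart (_ : n%:Z - j%:Z - 1 = n%:Z - j.+1%:Z); last by lia.
  move: IH; move: (dpart _) (dpart _) (dpart _) (part _) (part _) => a b c p q.
  move=> *; nia.
have S (k : nat) : (k <= h)%N ->
    B%:Z * (k%:Z * dpart n%:Z) <= B%:Z * (part n%:Z - part (n%:Z - k%:Z)) + k%:Z * (h%:Z * (4 * part n%:Z)).
  elim: k => [|k IH] kh; first by rewrite (subr0 n%:Z) addrN !mul0r !mulr0.
  have {}IH := IH (ltnW kh); have := E k (ltnW kh).
  have hk : k%:Z * (4 * part n%:Z) <= h%:Z * (4 * part n%:Z).
    by rewrite ler_wpM2r ?mulr_ge0 //; lia.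
  rewrite /dpart (_ : n%:Z - k%:Z - 1 = n%:Z - k.+1%:Z); last by lia.
  rewrite -/(dpart n%:Z); move: IH hk; rewrite !intS.
  move: (dpart _) (part (_ - _)) (part (_ - _)) (part _) => *; nia.
have := S h (leqnn h).
have B0 : 0 < B%:Z by rewrite /B; lia.
have := zpart_ge0 `|n%:Z - h%:Z| (n%:Z - h%:Z); rewrite -/(part _) => q0 H.
rewrite -(ler_pM2l B0); apply: le_trans H _.
have -> : B%:Z = 4 * (h%:Z * h%:Z) by rewrite /B; lia.
have hq := mulr_ge0 (mulr_ge0 (ler0n int h) (ler0n int h)) q0.
rewrite !natz in hq; lra.
Qed.

(** In the size identity for [4 * k], keep only [t = 1] and [k <= i < 2 * k]: these are [k] terms,
    each at least [k * part (2 * k)]. *)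
Lemma part_quarter (k : nat) : (0 < k)%N -> k%:Z * part (2 * k)%N%:Z <= 4 * part (4 * k)%N%:Z.
Proof.
move=> k0; have := @part_sum_sizes (4 * k) (4 * k)%N%:Z (lexx _).
have H : \sum_(k <= i < 2 * k) k%:Z * part (2 * k)%N%:Z
   <= \sum_(1 <= i < (4 * k).+1) \sum_(1 <= t < (4 * k).+1) i%:Z * part ((4 * k)%N%:Z - (i * t)%N%:Z).
  have P0 z : 0 <= part z by exact: zpart_ge0.
  have T0 (i : nat) : 0 <= \sum_(1 <= t < (4 * k).+1) i%:Z * part ((4 * k)%N%:Z - (i * t)%N%:Z).
    by rewrite sumr_ge0 // => t _; rewrite mulr_ge0.
  have k4 : (k <= (4 * k).+1)%N by lia.
  have k2 : (k <= 2 * k)%N by lia.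
  have k24 : (2 * k <= (4 * k).+1)%N by lia.
  rewrite [leRHS](big_cat_nat (n := k)) // [X in _ <= _ + X](big_cat_nat (n := (2 * k)%N)) //.
  rewrite addrCA -[leLHS]addr0; apply: lerD; last by rewrite addr_ge0 // sumr_ge0.
  apply: ler_sum_nat => i /andP[ki i2].
  rewrite big_ltn; last by lia.
  rewrite -[leLHS]addr0; apply: lerD; last first.
    by rewrite sumr_ge0 // => t _; rewrite mulr_ge0.
  by rewrite ler_pM //; apply: part_homo; lia.
move: H; rewrite sumr_const_nat (_ : (2 * k - k = k)%N); last by lia.
rewrite -[X in X <= _]mulr_natl natz => H E; rewrite -E in H.
have k0' : 0 < k%:Z by lia.
rewrite -(ler_pM2l k0'); apply: le_trans H _.
by rewrite PoszM -mulrA mulrCA.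
Qed.

(** Two applications of [part_quarter] to the linear bound gain two powers of [k]; cubic growth is
    enough to beat the quadratic error at the end. *)
Lemma part_cubic (k : nat) : (k ^ 3)%N%:Z <= 4 * part (8 * k)%N%:Z.
Proof.
case: k => [|k]; first by rewrite mulr_ge0 // zpart_ge0.
have := @part_quarter (2 * k.+1) isT; have := @part_quarter k.+1 isT.
have := part_ge_id (2 * k.+1).
rewrite (_ : (4 * (2 * k.+1) = 8 * k.+1)%N); last by lia.
rewrite (_ : (2 * (2 * k.+1) = 4 * k.+1)%N); last by lia.
move: (part (2 * _)%N%:Z) (part (4 * _)%N%:Z) (part (8 * _)%N%:Z) => a b c h1 h2 h3.
rewrite !expnS expn0; nia.
Qed.

(** * Logarithm estimates *)

Lemma atanh_series (R : realType) (t : R) : 0 <= t <= 2^-1 ->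
  0 <= ln (1 + t) - ln (1 - t) - 2 * t - 2 / 3 * t ^+ 3 <= 3 * t ^+ 5.
Proof.
move=> /andP[t0 t2].
pose f (x : R) := ln (1 + x) - ln (1 - x) - 2 * x - 2 / 3 * x ^+ 3.
(* Derivative of the Taylor remainder [f]; it lies between 0 and [3 * x ^+ 4] on [0, 1/2], and the
   mean value theorem concludes. *)
pose df (x : R) := 2 * x ^+ 4 / (1 - x ^+ 2).
have fdf (x : R) : 0 <= x <= 2^-1 -> is_derive x 1 f (df x).
  move=> xt.
  have p1 : 0 < 1 + x by lra.
  have p2 : 0 < 1 - x by lra.
  have h0 : is_derive x 1 (fun x : R => 1 + x) 1.
    apply: is_derive_eq. by rewrite ?(sub0r, add0r, mulr1, mul1r).
  have h0' : is_derive x 1 (fun x : R => 1 - x) (-1).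
    apply: is_derive_eq. by rewrite ?(sub0r, add0r, mulr1, mul1r).
  have h1 : is_derive x 1 (fun x : R => ln (1 + x)) ((1 + x)^-1).
    rewrite -[(1 + x)^-1]mulr1.
    exact: (is_derive1_comp (is_derive1_ln p1) h0).
  have h2 : is_derive x 1 (fun x : R => ln (1 - x)) (- (1 - x)^-1).
    rewrite -[- (1 - x)^-1]mulrN1.
    exact: (@is_derive1_comp R (@ln R) (fun x : R => 1 - x) x _ _ (is_derive1_ln p2) h0').
  rewrite /f /df.
  apply: is_derive_eq; rewrite /GRing.scale /=.
  by field; apply/and3P; split; apply/eqP; nra.
have [||c cI] := @MVT_segment _ f df 0 t t0.
- by move=> x /itvP xI; apply: fdf; rewrite !xI /= (le_trans (ltW _) t2) ?xI.
- apply: derivable_within_continuous => x /itvP xI.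
  have : is_derive x 1 f (df x) by apply: fdf; rewrite !xI /= (le_trans _ t2) ?xI.
  by case.
have c0 : 0 <= c by rewrite (itvP cI).
have ct : c <= t by rewrite (itvP cI).
have -> : f 0 = 0 by rewrite /f addr0 subr0 ln1 expr0n /=; ring.
rewrite !subr0 -/(f t) => ->.
have c4 : c ^+ 4 <= t ^+ 4 by rewrite lerXn2r.
have c40 : 0 <= c ^+ 4 by rewrite exprn_ge0.
have cc : 0 < 1 - c ^+ 2 by nra.
have h0 : 0 <= df c by rewrite /df divr_ge0 //; nra.
have h1 : df c <= 3 * t ^+ 4.
  rewrite /df ler_pdivrMr //.
  have t40 : 0 <= t ^+ 4 by rewrite exprn_ge0.
  have c2 : c ^+ 2 <= 4^-1 by nra.
  have : t ^+ 4 * c ^+ 2 <= t ^+ 4 * 4^-1 by rewrite ler_wpM2l.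
  lra.
apply/andP; split; first by rewrite mulr_ge0.
by rewrite exprSr mulrA ler_wpM2r.
Qed.

(* Substituting [1 + s = (1 + t) / (1 - t)]. *)
Lemma ln1D_approx (R : realType) (s : R) : `|s| <= 2^-1 ->
  `|ln (1 + s) - (s - s ^+ 2 / 2)| <= `|s| ^+ 3.
Proof.
move=> s2.
have [s_lo s_hi] : - 2^-1 <= s /\ s <= 2^-1 by apply/andP; rewrite -ler_norml.
have s2p : 0 < 2 + s by lra.
pose t := s / (2 + s).
have tE : t * (2 + s) = s by rewrite /t; field; lra.
have quad : 2 * t - (s - s ^+ 2 / 2) = s ^+ 3 / (2 * (2 + s)).
  by rewrite /t; field; apply/eqP; lra.
have lnE : ln (1 + s) = ln (1 + t) - ln (1 - t).
  have a : 0 < 1 + t by nra.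
  have b : 0 < 1 - t by nra.
  rewrite -ln_div ?posrE //; congr ln; rewrite /t; field.
  by apply/andP; split; apply/eqP; lra.
have [s0|s0] := leP 0 s.
  have t0 : 0 <= t by rewrite divr_ge0 // ltW.
  have ts : t <= s / 2 by rewrite ler_wpM2l // lef_pV2 ?posrE //; lra.
  have /andP[lo hi] := @atanh_series R t (ltac:(lra)).
  have q1 : 0 <= s ^+ 3 / (2 * (2 + s)) <= s ^+ 3 / 4.
    rewrite divr_ge0 ?exprn_ge0 //=; last by lra.
    by rewrite ler_wpM2l ?exprn_ge0 // lef_pV2 ?posrE //; lra.
  have t3 : 0 <= t ^+ 3 <= (s / 2) ^+ 3.
    by rewrite exprn_ge0 //= lerXn2r ?nnegrE //; lra.
  have t5 : t ^+ 5 <= t ^+ 3 / 16.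
    rewrite (_ : t ^+ 5 = t ^+ 3 * t ^+ 2); last by ring.
    by rewrite ler_wpM2l ?exprn_ge0 //; nra.
  rewrite (ger0_norm s0) lnE ler_norml.
  set q := s ^+ 3 / (2 * (2 + s)) in q1 quad.
  lra.
(* [atanh_series] needs a nonnegative argument; passing to [- t] exchanges the two logarithms. *)
pose r := - t.
have r0 : 0 <= r by rewrite /r oppr_ge0 ltW // pmulr_llt0 ?invr_gt0.
have rs : r <= 2 / 3 * - s.
  have : (-s) * (2 + s)^-1 <= (- s) * (2 / 3).
    rewrite ler_wpM2l //; first by lra.
    by rewrite (_ : 2 / 3 = (3 / 2)^-1) ?lef_pV2 ?posrE //; [lra|lra|field].
  by rewrite /r /t; lra.
have /andP[lo hi] := @atanh_series R r (ltac:(lra)).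
have q1 : 0 <= (- s) ^+ 3 / (2 * (2 + s)) <= (- s) ^+ 3 / 3.
  have s3 : 0 <= (- s) ^+ 3 by rewrite exprn_ge0 //; lra.
  rewrite divr_ge0 //=; last by lra.
  by rewrite ler_wpM2l // lef_pV2 ?posrE //; lra.
have r3 : 0 <= r ^+ 3 <= (2 / 3 * - s) ^+ 3.
  by rewrite exprn_ge0 //= lerXn2r ?nnegrE //; lra.
have r5 : r ^+ 5 <= r ^+ 3 / 9.
  rewrite (_ : r ^+ 5 = r ^+ 3 * r ^+ 2); last by ring.
  rewrite ler_wpM2l ?exprn_ge0 //.
  have r2 : r <= 1 / 3 by lra.
  by nra.
rewrite (ltr0_norm s0) lnE ler_norml.
have quad2 : 2 * r + s - s ^+ 2 / 2 = (- s) ^+ 3 / (2 * (2 + s)).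
  rewrite (_ : (- s) ^+ 3 = - s ^+ 3) ?mulNr -?quad /r; ring.
set q := (- s) ^+ 3 / (2 * (2 + s)) in q1 quad2.
rewrite /r opprK in lo hi r3 r5 quad2.
lra.
Qed.

(* The Euler-Maclaurin expansion of the harmonic sum, one term at a time. *)
Lemma ln_ratio_inv (R : realType) (j : R) : 1 <= j ->
  `|ln (j + 2^-1) - ln (j - 2^-1) + 24^-1 * ((j + 2^-1) ^- 2 - (j - 2^-1) ^- 2) - j^-1|
   <= (j ^+ 5)^-1.
Proof.
move=> j1; have j0 : 0 < j by lra.
pose t := (2 * j)^-1.
have tt : 0 <= t <= 2^-1.
  by rewrite /t invr_ge0 lef_pV2 ?posrE; lra.
have /andP[lo hi] := atanh_series tt.
have tj : t * j = 2^-1 by rewrite /t; field; lra.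
have jt : j^-1 = 2 * t by rewrite /t; field; lra.
have lnE : ln (j + 2^-1) - ln (j - 2^-1) = ln (1 + t) - ln (1 - t).
  have -> : j + 2^-1 = j * (1 + t) by lra.
  have -> : j - 2^-1 = j * (1 - t) by lra.
  by rewrite !lnM ?posrE //; try lra; ring.
have -> : (j ^+ 5)^-1 = 32 * t ^+ 5 by rewrite -exprVn jt; ring.
have t1 : 0 < 1 - t ^+ 2 by nra.
(* The correction cancels the cubic term of the series of [ln (1 + t) - ln (1 - t)], leaving an
   error of order [t ^+ 5]. *)
have -> : 24^-1 * ((j + 2^-1) ^- 2 - (j - 2^-1) ^- 2)
    = - (2 / 3) * t ^+ 3 * (1 - t ^+ 2) ^- 2.
  rewrite /t; field; do ?[apply/andP; split]; apply/eqP; nra.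
rewrite lnE jt.
have inv : 1 <= (1 - t ^+ 2) ^- 2 <= 1 + 4 * t ^+ 2.
  have y0 : 0 <= t ^+ 2 <= 4^-1 by nra.
  move: (t ^+ 2) y0 t1 => y y0 t1.
  have z0 : 0 < (1 - y) ^+ 2 by rewrite exprn_gt0.
  rewrite invf_ge1 // -[X in _ && (X <= _)]mul1r ler_pdivrMr //.
  by apply/andP; split; nra.
have t3 : 0 <= t ^+ 3 by rewrite exprn_ge0; lra.
have tq : t ^+ 3 * (1 - t ^+ 2) ^- 2 <= t ^+ 3 + 4 * t ^+ 5.
  rewrite (_ : _ + _ = t ^+ 3 * (1 + 4 * t ^+ 2)); last by ring.
  by rewrite ler_wpM2l //; case/andP: inv.
have tp : t ^+ 3 <= t ^+ 3 * (1 - t ^+ 2) ^- 2 by rewrite ler_peMr //; case/andP: inv.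
have t5 : 0 <= t ^+ 5 by rewrite exprn_ge0; lra.
rewrite ler_norml -mulrA.
set w := t ^+ 3 * (1 - t ^+ 2) ^- 2 in tq tp *.
lra.
Qed.

(** * The trapezoid rule and Euler-Maclaurin *)

(** Row [j] of F_1; the argument is real because F_m(X) is later reduced to F_1 at X / m. *)
Definition hat_row (R : realType) (j : nat) (Y : R) : R :=
  \sum_(0 <= k < j.+1) (string_weight j k)%:R * Num.max 0 (Y - (j ^ 2 + j * k)%N%:R).

(** For [j >= 1], twice the integral over u in [0, j] of max(0, Y - j^2 - j u); the cases place the
    kink before, inside or beyond the interval. *)
Definition trapezoid (R : realType) (j : nat) (Y : R) : R :=
  if Y <= j%:R ^+ 2 then 0
  else if Y <= 2 * j%:R ^+ 2 then (Y - j%:R ^+ 2) ^+ 2 / j%:R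
  else 2 * Y * j%:R - 3 * j%:R ^+ 3.

Lemma sum_weight_lin (R : realType) (j t : nat) (Z : R) : (0 < j)%N -> (t < j)%N ->
  \sum_(0 <= k < t.+1) (string_weight j k)%:R * (Z - (j * k)%N%:R)
  = Z * (2 * t%:R + 1) - j%:R * t%:R * (t%:R + 1).
Proof.
move=> j0; elim: t => [|t IH] tj.
  by rewrite big_nat1 /string_weight j0 /= muln0 !mul1r; ring.
rewrite big_nat_recr //= IH 1?ltnW // /string_weight j0 /= (ltnW tj).
rewrite (_ : t.+1 == j = false) /=; last by lia.
by rewrite natrM -!natr1; ring.
Qed.

Lemma sum_weight_full (R : realType) (j : nat) (Z : R) : (0 < j)%N ->
  \sum_(0 <= k < j.+1) (string_weight j k)%:R * (Z - (j * k)%N%:R)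
  = 2 * Z * j%:R - j%:R ^+ 3.
Proof.
case: j => // j _; rewrite big_nat_recr // sum_weight_lin //=.
rewrite /string_weight /= leqnn eqxx /=.
by rewrite natrM -!natr1; ring.
Qed.

(* Up to the factor 2, the row sum is the trapezoid rule on [0, j] for the
   convex function k |-> max 0 (Y - j^2 - j k), which is affine except at its
   single kink; the error is j * theta * (1 - theta) where theta is the
   fractional part of the position of the kink. *)
Lemma hat_row_trapezoid (R : realType) (j : nat) (Y : R) : (0 < j)%N -> 0 <= Y ->
  trapezoid j Y <= hat_row j Y
  <= trapezoid j Y + (if (j%:R ^+ 2 < Y < 2 * j%:R ^+ 2) then j%:R / 4 else 0).
Proof.
move=> j0 Y0; rewrite /trapezoid /hat_row.
have j0' : 0 < j%:R :> R by rewrite ltr0n.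
have e k : Y - (j ^ 2 + j * k)%N%:R = (Y - j%:R ^+ 2) - (j * k)%N%:R.
  by rewrite natrD natrX; ring.
under eq_bigr do rewrite e.
set Z := Y - j%:R ^+ 2.
case: (leP Y (j%:R ^+ 2)) => h1 /=.
  rewrite big1_seq ?addr0 ?lexx // => k _.
  rewrite max_l ?mulr0 // /Z; have : 0 <= (j * k)%N%:R :> R by []. lra.
case: (leP Y (2 * j%:R ^+ 2)) => h2 /=; last first.
  rewrite ltNge (ltW h2) /= addr0.
  rewrite [X in _ <= X <= _](_ : _
    = \sum_(0 <= k < j.+1) (string_weight j k)%:R * (Z - (j * k)%N%:R)).
    rewrite sum_weight_full // /Z; apply/andP; split; rewrite le_eqVlt; apply/orP; left; apply/eqP; ring.
  apply: eq_big_nat => k /andP[_ kj]; rewrite max_r // natrM /Z.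
  have : k%:R <= j%:R :> R by rewrite ler_nat.
  by nra.
have Z0 : 0 < Z by rewrite /Z; lra.
have ZJ : Z <= j%:R ^+ 2 by rewrite /Z; lra.
(* A kink exactly at the endpoint [j] is handled apart, as [sum_weight_lin] requires [t < j]. *)
have [ZE|ZN] := eqVneq Z (j%:R ^+ 2).
  rewrite [X in _ <= X <= _](_ : _ = \sum_(0 <= k < j.+1) (string_weight j k)%:R * (Z - (j * k)%N%:R)).
    rewrite sum_weight_full // ZE.
    have -> : (j%:R ^+ 2) ^+ 2 / j%:R = j%:R ^+ 3 :> R by field; lra.
    by apply/andP; split; [lra|case: ifP => _; lra].
  apply: eq_big_nat => k /andP[_ kj]; rewrite max_r // natrM ZE.
  have : k%:R <= j%:R :> R by rewrite ler_nat.
  by nra.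
have -> : Y < 2 * j%:R ^+ 2.
  by rewrite lt_neqAle h2 andbT; apply: contra_neq ZN => YE; rewrite /Z; lra.
pose t := Num.truncn (Z / j%:R).
have Zj0 : 0 <= Z / j%:R by rewrite divr_ge0 // ltW.
have /andP[t1 t2] := Num.Theory.truncn_itv Zj0.
rewrite -/t in t1 t2.
have tj : (t < j)%N.
  rewrite -(ltr_nat R); apply: le_lt_trans t1 _.
  by rewrite ltr_pdivrMr // -expr2 lt_neqAle ZN.
rewrite (big_cat_nat (n := t.+1)) //=; last by rewrite ltnW.
rewrite [X in _ <= _ + X <= _]big1_seq ?addr0; last first.
  move=> k; rewrite mem_index_iota => /andP[_ /andP[tk _]].
  rewrite max_l ?mulr0 // natrM subr_le0 -ler_pdivrMl // mulrC.
  by apply: (le_trans (ltW t2)); rewrite ler_nat.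
rewrite [X in _ <= X <= _](_ : _
  = \sum_(0 <= k < t.+1) (string_weight j k)%:R * (Z - (j * k)%N%:R)); last first.
  apply: eq_big_nat => k /andP[_ kt]; rewrite max_r // natrM subr_ge0 -ler_pdivlMl // mulrC.
  by apply: le_trans t1; rewrite ler_nat.
rewrite sum_weight_lin //.
have t2' : Z / j%:R < t%:R + 1 by rewrite natr1.
pose x := Z / j%:R.
have ZE : Z = j%:R * x by rewrite /x; field; lra.
rewrite -/x in t1 t2'; rewrite ZE.
have -> : (j%:R * x) ^+ 2 / j%:R = j%:R * x ^+ 2 by field; lra.
have E : j%:R * x * (2 * t%:R + 1) - j%:R * t%:R * (t%:R + 1)
  = j%:R * x ^+ 2 + j%:R * ((x - t%:R) * (1 - (x - t%:R))) by ring.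
have : 0 <= (x - t%:R) * (1 - (x - t%:R)) <= 4^-1.
  have : 0 <= x - t%:R < 1 by rewrite subr_ge0 t1 ltrBlDl.
  move: (x - t%:R) => d /andP[d0 d1]; have hq := sqr_ge0 (d - 2^-1).
  by apply/andP; split; nra.
move=> /andP[d0 d1]; rewrite E lerDl lerD2l mulr_ge0 ?(ltW j0') //=.
by rewrite ler_wpM2l ?(ltW j0').
Qed.

(** Written in [(n + 1/2) ^+ 2], like the sum of cubes below, to match the midpoints in the harmonic
    sum. *)
Lemma sum_id (R : realType) (n : nat) :
  \sum_(1 <= j < n.+1) j%:R = ((n%:R + 2^-1) ^+ 2 - 4^-1) / 2 :> R.
Proof.
elim: n => [|n IH]; first by rewrite big_nil; field.
by rewrite big_nat_recr //= IH -natr1; field.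
Qed.

Lemma sum_cubes (R : realType) (n : nat) :
  \sum_(1 <= j < n.+1) j%:R ^+ 3 = (((n%:R + 2^-1) ^+ 2 - 4^-1) / 2) ^+ 2 :> R.
Proof.
elim: n => [|n IH]; first by rewrite big_nil; field.
by rewrite big_nat_recr //= IH -natr1; field.
Qed.

Lemma sum_nat_diff (R : realType) (F : nat -> R) (J L : nat) : (J <= L)%N ->
  \sum_(J.+1 <= j < L.+1) F j = \sum_(1 <= j < L.+1) F j - \sum_(1 <= j < J.+1) F j.
Proof. by move=> JL; rewrite [in RHS](big_cat_nat (n := J.+1)) //= addrAC subrr add0r. Qed.

Lemma sum_inv (R : realType) (J L : nat) : (J <= L)%N ->
  `|\sum_(J.+1 <= j < L.+1) j%:R^-1
    - (ln (L%:R + 2^-1) - ln (J%:R + 2^-1)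
       + 24^-1 * ((L%:R + 2^-1) ^- 2 - (J%:R + 2^-1) ^- 2))|
  <= (L - J)%:R / (J.+1%:R ^+ 5) :> R.
Proof.
elim: L => [|L IH].
  by rewrite leqn0 => /eqP ->; rewrite big_geq // subnn mul0r normr_le0; apply/eqP; ring.
rewrite leq_eqVlt => /orP[/eqP <-|]; first by rewrite big_geq // subnn mul0r normr_le0; apply/eqP; ring.
rewrite ltnS => JL; rewrite big_nat_recr //= subSn // -[(L - J).+1%:R]natr1 mulrDl mul1r.
have h : `|ln (L.+1%:R + 2^-1) - ln (L.+1%:R - 2^-1)
    + 24^-1 * ((L.+1%:R + 2^-1) ^- 2 - (L.+1%:R - 2^-1) ^- 2) - L.+1%:R^-1|
   <= (L.+1%:R ^+ 5)^-1 :> R by apply: ln_ratio_inv; rewrite ler1n.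
have e : L.+1%:R - 2^-1 = L%:R + 2^-1 :> R by rewrite -natr1; lra.
rewrite e in h.
have h5 : (L.+1%:R ^+ 5)^-1 <= (J.+1%:R ^+ 5)^-1 :> R.
  by rewrite lef_pV2 ?posrE ?exprn_gt0 // lerXn2r ?nnegrE // ler_nat.
apply: le_trans (lerD (IH JL) (le_trans h h5)).
rewrite [X in _ <= _ + X]distrC; apply: le_trans (ler_normD _ _).
by rewrite le_eqVlt; apply/orP; left; apply/eqP; congr (`| _ |); ring.
Qed.

(** [J] and [L] are the integer parts of sqrt(Y / 2) and sqrt Y, where the rows change regime; at
    the borderline [j] the neighbouring formulas agree. *)
Lemma sum_trapezoid (R : realType) (J L N : nat) (Y : R) : (J <= L)%N -> (L <= N)%N ->
  2 * J%:R ^+ 2 <= Y -> Y < 2 * J.+1%:R ^+ 2 -> L%:R ^+ 2 <= Y -> Y < L.+1%:R ^+ 2 ->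
  \sum_(1 <= j < N.+1) trapezoid j Y
  = \sum_(1 <= j < J.+1) (2 * Y * j%:R - 3 * j%:R ^+ 3)
    + \sum_(J.+1 <= j < L.+1) (Y ^+ 2 * j%:R^-1 - 2 * Y * j%:R + j%:R ^+ 3).
Proof.
move=> JL LN J1 J2 L1 L2.
have mono (i j : nat) : (i <= j)%N -> i%:R ^+ 2 <= j%:R ^+ 2 :> R.
  by move=> ij; rewrite lerXn2r ?nnegrE // ler_nat.
rewrite (big_cat_nat (n := J.+1)) //=; last by rewrite ltnS (leq_trans JL).
rewrite [X in _ + X = _](big_cat_nat (n := L.+1)) //=.
rewrite [X in _ + (_ + X) = _]big1_seq ?addr0; last first.
  move=> j; rewrite mem_index_iota => /andP[_ /andP[Lj _]].
  by rewrite /trapezoid ifT // (le_trans (ltW L2)) // mono.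
congr (_ + _); apply: eq_big_nat => j /andP[j1 j2].
  have j0 : 0 < j%:R :> R by rewrite ltr0n.
  have jj := mono j J j2.
  rewrite /trapezoid ifF; last by apply/negbTE; rewrite -ltNge; nra.
  case: leP => // h; have -> : Y = 2 * j%:R ^+ 2 by lra.
  by field; lra.
have j0 : 0 < j%:R :> R by rewrite ltr0n (leq_trans _ j1).
have jj := mono J.+1 j j1; have jl := mono j L j2.
rewrite /trapezoid; case: leP => h.
  have -> : Y = j%:R ^+ 2 by lra.
  by field; lra.
by rewrite ifT; [field; lra|lra].
Qed.

(** [s1] and [s2] are the relative rounding errors of the cut-offs. The polynomial sums cancel the
    first two Taylor terms of [ln (1 + s1)] and [ln (1 + s2)] at order [Y ^+ 2], so only logarithmic
    remainders survive there. *)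
Lemma sum_trapezoid_eval (R : realType) (J L : nat) (Y s1 s2 : R) : (J <= L)%N ->
  0 < 1 + s1 -> 0 < 1 + s2 -> 0 < Y ->
  (J%:R + 2^-1) ^+ 2 = Y * (1 + s1) / 2 -> (L%:R + 2^-1) ^+ 2 = Y * (1 + s2) ->
  \sum_(1 <= j < J.+1) (2 * Y * j%:R - 3 * j%:R ^+ 3)
    + \sum_(J.+1 <= j < L.+1) (Y ^+ 2 * j%:R^-1 - 2 * Y * j%:R + j%:R ^+ 3)
  = ln 2 / 2 * Y ^+ 2 - Y / 6
    + Y ^+ 2 / 2 * ((ln (1 + s2) - (s2 - s2 ^+ 2 / 2)) - (ln (1 + s1) - (s1 - s1 ^+ 2 / 2)))
    + Y * (s1 / 4 - s2 / 8 - (s2 / (1 + s2) - 2 * (s1 / (1 + s1))) / 24)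
    + Y ^+ 2 * (\sum_(J.+1 <= j < L.+1) j%:R^-1
        - (ln (L%:R + 2^-1) - ln (J%:R + 2^-1)
           + 24^-1 * ((L%:R + 2^-1) ^- 2 - (J%:R + 2^-1) ^- 2)))
    - 3 / 64.
Proof.
move=> JL p1 p2 Y0 E1 E2.
have a0 : 0 < J%:R + 2^-1 :> R by have := ler0n R J; lra.
have b0 : 0 < L%:R + 2^-1 :> R by have := ler0n R L; lra.
have lnb : ln (L%:R + 2^-1) = (ln Y + ln (1 + s2)) / 2 :> R.
  by have := lnXn 2 b0; rewrite E2 lnM ?posrE // (mulr2n (ln _)); move: (ln _) (ln _) (ln _) => *; lra.
have lna : ln (J%:R + 2^-1) = (ln Y + ln (1 + s1) - ln 2) / 2 :> R.
  have p : 0 < Y * (1 + s1) by rewrite mulr_gt0.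
  have := lnXn 2 a0; rewrite E1 ln_div ?posrE // lnM ?posrE // (mulr2n (ln _)).
  by move: (ln _) (ln _) (ln _) (ln _) => *; lra.
rewrite lnb lna !big_split /= !sumrN -!mulr_sumr.
rewrite (@sum_nat_diff R (fun j => j%:R) _ _ JL) (@sum_nat_diff R (fun j => j%:R ^+ 3) _ _ JL).
rewrite !sum_id !sum_cubes E1 E2.
set H := \sum_(_ <= _ < _) _^-1.
move: (ln _) (ln _) (ln _) (ln _) H => l1 l2 l3 l4 H.
field.
by do ?[apply/andP; split]; apply/eqP; lra.
Qed.

Lemma trapezoid_sum_bound (R : realType) (J L : nat) (x : R) : 16 <= x ->
  2 * J%:R ^+ 2 <= x ^+ 2 -> x ^+ 2 < 2 * J.+1%:R ^+ 2 ->
  L%:R ^+ 2 <= x ^+ 2 -> x ^+ 2 < L.+1%:R ^+ 2 ->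
  [/\ (J <= L)%N,
      `|\sum_(1 <= j < J.+1) (2 * x ^+ 2 * j%:R - 3 * j%:R ^+ 3)
        + \sum_(J.+1 <= j < L.+1) ((x ^+ 2) ^+ 2 * j%:R^-1 - 2 * x ^+ 2 * j%:R + j%:R ^+ 3)
        - (ln 2 / 2 * x ^+ 4 - x ^+ 2 / 6)| <= 100 * x
    & \sum_(J.+1 <= j < L.+1) j%:R / 4 <= x ^+ 2 / 16 + x].
Proof.
move=> x16 J1 J2 L1 L2.
have j0 := ler0n R J; have l0 := ler0n R L.
rewrite -[J.+1%:R]natr1 in J2; rewrite -[L.+1%:R]natr1 in L2.
have Jx : J%:R <= x by nra.
have Lx : L%:R <= x by nra.
have Lx1 : x < L%:R + 1 by nra.
have JL : (J <= L)%N.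
  rewrite -ltnS -(ltr_nat R) -natr1; apply: le_lt_trans Lx1; exact: Jx.
pose s1 := 2 * (J%:R + 2^-1) ^+ 2 / x ^+ 2 - 1.
pose s2 := (L%:R + 2^-1) ^+ 2 / x ^+ 2 - 1.
have xp : 0 < x by lra.
have x0 : x != 0 by rewrite gt_eqF.
have E1 : (J%:R + 2^-1) ^+ 2 = x ^+ 2 * (1 + s1) / 2 by rewrite /s1; field.
have E2 : (L%:R + 2^-1) ^+ 2 = x ^+ 2 * (1 + s2) by rewrite /s2; field.
have x2 : 0 < x ^+ 2 by nra.
(* Rounding moves the squared cut-offs by O(x) out of [x ^+ 2]. With [s1] and [s2] of order 1/x, the
   cubic log remainders times [x ^+ 4] are O(x). *)
have s1x : `|s1| <= 4 / x.
  rewrite ler_norml.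
  have h : - (4 * x) <= x ^+ 2 * s1 <= 4 * x by apply/andP; split; nra.
  rewrite (_ : s1 = (x ^+ 2 * s1) / x ^+ 2); last by field.
  rewrite ler_pdivrMr // ler_pdivlMr // mulNr (_ : 4 / x * x ^+ 2 = 4 * x) //.
  by field.
have s2x : `|s2| <= 4 / x.
  rewrite ler_norml.
  have h : - (4 * x) <= x ^+ 2 * s2 <= 4 * x by apply/andP; split; nra.
  rewrite (_ : s2 = (x ^+ 2 * s2) / x ^+ 2); last by field.
  rewrite ler_pdivrMr // ler_pdivlMr // mulNr (_ : 4 / x * x ^+ 2 = 4 * x) //.
  by field.
clearbody s1 s2.
have x4 : 4 / x <= 4^-1 by rewrite ler_pdivrMr; lra.
have [s1l s1u] : - (4 / x) <= s1 /\ s1 <= 4 / x by apply/andP; rewrite -ler_norml.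
have [s2l s2u] : - (4 / x) <= s2 /\ s2 <= 4 / x by apply/andP; rewrite -ler_norml.
have xs (u : R) : `|u| <= 4 / x -> x ^+ 2 * `|u| <= 4 * x.
  move=> h; apply: le_trans (ler_wpM2l (ltW x2) h) _.
  by rewrite le_eqVlt; apply/orP; left; apply/eqP; field.
split=> //; last first.
  rewrite -mulr_suml (@sum_nat_diff R (fun j => j%:R) _ _ JL) !sum_id E1 E2.
  have := xs _ s1x; have := xs _ s2x.
  have := ler_norm s2; have := ler_norm (- s1); rewrite normrN.
  move: (`|s1|) (`|s2|) => n1 n2 h1 h2 h3 h4; nra.
rewrite (@sum_trapezoid_eval _ _ _ _ s1 s2) //; [|lra|lra].
set e2 := ln (1 + s2) - _; set e1 := ln (1 + s1) - _; set er := _ - (_ + _ * _).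
have b1 : `|e1| <= 64 / x ^+ 3.
  apply: le_trans (ln1D_approx _) _; first by lra.
  rewrite (_ : 64 / x ^+ 3 = (4 / x) ^+ 3); last by field.
  by rewrite lerXn2r ?nnegrE // (le_trans _ s1x).
have b2 : `|e2| <= 64 / x ^+ 3.
  apply: le_trans (ln1D_approx _) _; first by lra.
  rewrite (_ : 64 / x ^+ 3 = (4 / x) ^+ 3); last by field.
  by rewrite lerXn2r ?nnegrE // (le_trans _ s2x).
have ber : `|er| <= 8 / x ^+ 4.
  apply: le_trans (sum_inv _ JL) _; rewrite -natr1.
  have z2 : x ^+ 2 <= 2 * (J%:R + 1) ^+ 2 by lra.
  have z4 : x ^+ 4 <= 4 * (J%:R + 1) ^+ 4.
    have w0 : 0 <= 2 * (J%:R + 1) ^+ 2 :> R by exact: le_trans (ltW x2) z2.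
    have -> : x ^+ 4 = (x ^+ 2) ^+ 2 by ring.
    have -> : 4 * (J%:R + 1) ^+ 4 = (2 * (J%:R + 1) ^+ 2) ^+ 2 :> R by ring.
    by rewrite lerXn2r // nnegrE ltW.
  have z1 : (L - J)%:R <= 2 * (J%:R + 1) :> R by rewrite natrB //; nra.
  have y0 : 0 < J%:R + 1 :> R by exact: ltr_wpDl.
  have x40 : 0 < x ^+ 4 by rewrite exprn_gt0.
  rewrite ler_pdivrMr ?exprn_gt0 // mulrAC ler_pdivlMr //.
  rewrite (_ : 8 * _ = 2 * (J%:R + 1) * (4 * (J%:R + 1) ^+ 4)); last by ring.
  by rewrite ler_pM // ltW.
clearbody e1 e2 er.
have q1 : `|s1 / (1 + s1)| <= 2 * (4 / x).
  rewrite normrM normfV (ger0_norm (_ : 0 <= 1 + s1)); last by lra.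
  by rewrite ler_pdivrMr; [nra|lra].
have q2 : `|s2 / (1 + s2)| <= 2 * (4 / x).
  rewrite normrM normfV (ger0_norm (_ : 0 <= 1 + s2)); last by lra.
  by rewrite ler_pdivrMr; [nra|lra].
set r1 := s1 / (1 + s1) in q1 *; set r2 := s2 / (1 + s2) in q2 *.
rewrite [X in `|X|](_ : _ = x ^+ 4 / 2 * (e2 - e1)
  + x ^+ 2 * (s1 / 4 - s2 / 8 - (r2 - 2 * r1) / 24) + x ^+ 4 * er - 3 / 64); last by ring.
have B1 : `|x ^+ 4 / 2 * (e2 - e1)| <= 64 * x.
  have x42 : 0 <= x ^+ 4 / 2 by rewrite divr_ge0 ?exprn_ge0 ?(ltW xp).
  rewrite normrM (ger0_norm x42).
  have h : `|e2 - e1| <= 2 * (64 / x ^+ 3) by apply: le_trans (ler_normB _ _) _; lra.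
  rewrite (_ : 64 * x = x ^+ 4 / 2 * (2 * (64 / x ^+ 3))); last by field.
  exact: ler_wpM2l.
have B2 : `|x ^+ 2 * (s1 / 4 - s2 / 8 - (r2 - 2 * r1) / 24)| <= 10 * x.
  rewrite normrM (gtr0_norm x2) (_ : 10 * x = x ^+ 2 * (10 * x^-1)); last by field.
  rewrite ler_wpM2l ?(ltW x2) // ler_norml.
  move: q1 q2; rewrite !ler_norml => /andP[q1 q1'] /andP[q2 q2'].
  have : 0 < x^-1 by rewrite invr_gt0.
  by clearbody r1 r2; move: (x^-1) s1l s1u s2l s2u q1 q1' q2 q2' => *; apply/andP; split; lra.
have B3 : `|x ^+ 4 * er| <= 8.
  have x40 : 0 < x ^+ 4 by rewrite exprn_gt0.
  by rewrite normrM (gtr0_norm x40) mulrC -ler_pdivlMr.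
have B4 : `|3 / 64| <= 1 :> R by rewrite ger0_norm ?divr_ge0 // ler_pdivrMr // mul1r ler_nat.
apply: le_trans (ler_normB _ _) _.
apply: le_trans (lerD (ler_normD _ _) B4) _.
apply: le_trans (lerD (lerD (ler_normD _ _) B3) (lexx _)) _.
lra.
Qed.

Lemma floor_sqr (R : realType) (Y : R) : 0 <= Y ->
  exists n : nat, n%:R ^+ 2 <= Y /\ Y < n.+1%:R ^+ 2.
Proof.
move=> Y0; exists (Num.truncn (Num.sqrt Y)).
have /andP[h1 h2] := Num.Theory.truncn_itv (sqrtr_ge0 Y).
rewrite -[X in _ <= X](sqr_sqrtr Y0) -[X in X < _](sqr_sqrtr Y0).
by split; [rewrite lerXn2r ?nnegrE ?sqrtr_ge0|rewrite ltrXn2r ?nnegrE ?sqrtr_ge0].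
Qed.

(** The upper bound adds the errors [j / 4] for [J < j <= L], about [x ^+ 2 / 16] in total, and -1/6
    + 1/16 = -5/48. *)
Lemma hat_row_sum_bounds (R : realType) (N : nat) (x : R) : 16 <= x -> x ^+ 2 <= N%:R ->
  ln 2 / 2 * x ^+ 4 - x ^+ 2 / 6 - 100 * x
  <= \sum_(0 <= j < N) hat_row j (x ^+ 2)
  <= ln 2 / 2 * x ^+ 4 - 5 / 48 * x ^+ 2 + 101 * x.
Proof.
move=> x16 xN.
have x20 : 0 <= x ^+ 2 by rewrite sqr_ge0.
have [L [L1 L2]] := floor_sqr x20.
have [J [J1 J2]] : exists n : nat, n%:R ^+ 2 <= x ^+ 2 / 2 /\ x ^+ 2 / 2 < n.+1%:R ^+ 2.
  by apply: floor_sqr; rewrite divr_ge0.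
have {}J1 : 2 * J%:R ^+ 2 <= x ^+ 2 by lra.
have {}J2 : x ^+ 2 < 2 * J.+1%:R ^+ 2 by lra.
have [JL] := trapezoid_sum_bound x16 J1 J2 L1 L2.
have LN : (L < N)%N.
  rewrite -(ltr_nat R); apply: lt_le_trans xN.
  have : x < L.+1%:R by rewrite -(@ltr_pXn2r _ 2) ?nnegrE //; lra.
  by rewrite -natr1; nra.
case: N xN LN => // N xN LN; rewrite ltnS in LN.
rewrite -(sum_trapezoid JL LN) // => T E.
rewrite big_ltn // (_ : hat_row 0 (x ^+ 2) = 0) ?add0r; last by rewrite /hat_row big_nat1 mul0r.
have lo : \sum_(1 <= j < N.+1) trapezoid j (x ^+ 2) <= \sum_(1 <= j < N.+1) hat_row j (x ^+ 2).
  by apply: ler_sum_nat => j /andP[j0 _]; case/andP: (hat_row_trapezoid j0 x20).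
have hi : \sum_(1 <= j < N.+1) hat_row j (x ^+ 2)
    <= \sum_(1 <= j < N.+1) trapezoid j (x ^+ 2) + \sum_(J.+1 <= j < L.+1) j%:R / 4.
  have mono (i j : nat) : (i <= j)%N -> i%:R ^+ 2 <= j%:R ^+ 2 :> R.
    by move=> ij; rewrite lerXn2r ?nnegrE // ler_nat.
  pose d (j : nat) : R := if (j%:R ^+ 2 < x ^+ 2 < 2 * j%:R ^+ 2) then j%:R / 4 else 0.
  apply: (@le_trans _ _ (\sum_(1 <= j < N.+1) (trapezoid j (x ^+ 2) + d j))).
    by apply: ler_sum_nat => j /andP[j0 _]; case/andP: (hat_row_trapezoid j0 x20).
  rewrite big_split /= lerD2l.
  rewrite (big_cat_nat (n := J.+1)) //=; last by rewrite ltnS (leq_trans JL).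
  rewrite big1_seq ?add0r; last first.
    move=> j; rewrite mem_index_iota => /andP[_ /andP[_ jJ]].
    rewrite /d ifF //; apply/negbTE; rewrite negb_and -!leNgt; apply/orP; right.
    by apply: le_trans J1; rewrite ler_wpM2l // mono.
  rewrite (big_cat_nat (n := L.+1)) //= [X in _ + X]big1_seq ?addr0; last first.
    move=> j; rewrite mem_index_iota => /andP[_ /andP[Lj _]].
    rewrite /d ifF //; apply/negbTE; rewrite negb_and -!leNgt; apply/orP; left.
    by apply: (le_trans (ltW L2)); rewrite mono.
  by apply: ler_sum_nat => j _; rewrite /d; case: ifP => // _; rewrite divr_ge0.
move: T; rewrite ler_norml => /andP[T1 T2].
by apply/andP; split; lra.
Qed.

(** * The functions F_m and the linear lower bound for F_1 - m F_m *)

Definition hat_sum (m N X : nat) : nat :=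
  \sum_(0 <= j < N) \sum_(0 <= k < j.+1) string_weight j k * (X - m * (j ^ 2 + j * k)).

(** Scaling F_m(X) = m F_1(X / m); truncated subtraction in [hat_sum] stands for max(0, .). *)
Lemma hat_sum_row (R : realType) (m N X : nat) : (0 < m)%N ->
  (hat_sum m N X)%:R = m%:R * \sum_(0 <= j < N) hat_row j (X%:R / m%:R) :> R.
Proof.
move=> m0; rewrite /hat_sum natr_sum mulr_sumr; apply: eq_bigr => j _.
rewrite natr_sum /hat_row mulr_sumr; apply: eq_bigr => k _.
rewrite natrM mulrCA; congr (_ * _).
have mp : 0 < m%:R :> R by rewrite ltr0n.
set s := (j ^ 2 + j * k)%N.
case: (leqP (m * s) X) => h.
  rewrite natrB // natrM max_r.
    by rewrite mulrBr mulrCA divff ?mulr1 // gt_eqF.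
  by rewrite subr_ge0 ler_pdivlMr // mulrC -natrM ler_nat.
rewrite (_ : (X - m * s)%N = 0%N) ?max_l ?mulr0 //; last by lia.
by rewrite subr_le0 ler_pdivrMr // mulrC -natrM ler_nat ltnW.
Qed.

Lemma hat_sum_stable (m N X : nat) : (0 < m)%N -> (X <= N)%N -> hat_sum m N X = hat_sum m X X.
Proof.
move=> m0 XN; rewrite /hat_sum (big_cat_nat (n := X)) //=.
rewrite [X in (_ + X)%N]big1_seq ?addn0 // => j; rewrite mem_index_iota => /andP[_ /andP[Xj _]].
rewrite big1 // => k _; rewrite (_ : (X - _)%N = 0%N) ?muln0 //; nia.
Qed.

Lemma hat_sum_diff_ge_large (R : realType) (m N X : nat) : (1 < m)%N -> (X <= N)%N ->
  ((48 * (100 + 101 * m ^ 2)) ^ 2 <= X)%N ->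
  X%:R <= 48 * ((hat_sum 1 N X)%:R - m%:R * (hat_sum m N X)%:R) :> R.
Proof.
(* The gain [(5 * m - 8) / 48 * X] is at least [2 * X / 48]; as [sqrt X >= D], half of this absorbs
   the error [(100 + 101 * m ^ 2) * sqrt X]. *)
set D := (48 * _)%N => m1 XN XD; have m0 : (0 < m)%N by lia.
rewrite (hat_sum_row R N X m0) (@hat_sum_row R 1 N X isT) divr1 mul1r.
have mp : 2 <= m%:R :> R by rewrite ler_nat.
pose x : R := Num.sqrt X%:R; pose y : R := Num.sqrt (X%:R / m%:R).
have xE : X%:R = x ^+ 2 by rewrite sqr_sqrtr.
have yE : X%:R / m%:R = y ^+ 2 by rewrite sqr_sqrtr // divr_ge0.
have Dx : D%:R <= x.
  by rewrite -(@ler_pXn2r _ 2) ?nnegrE ?sqrtr_ge0 // -xE -natrX ler_nat.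
have DE : D%:R = 48 * (100 + 101 * m%:R ^+ 2) :> R by rewrite /D natrM natrD natrM natrX.
have x0 : 0 <= x by exact: sqrtr_ge0.
have y0 : 0 <= y by exact: sqrtr_ge0.
have xy : x ^+ 2 = m%:R * y ^+ 2 by rewrite -xE -yE mulrCA divff ?mulr1 //; lra.
have yx : y <= x by nra.
have y16 : 16 <= y.
  rewrite leNgt; apply/negP => y16.
  have mx : 16 * m%:R <= x :> R by apply: (le_trans _ Dx); rewrite DE; nra.
  have : (16 * m%:R) ^+ 2 <= x ^+ 2 by rewrite lerXn2r ?nnegrE //; lra.
  have : y ^+ 2 < 256 by nra.
  by rewrite xy; nra.
have xN : x ^+ 2 <= N%:R by rewrite -xE ler_nat.
have yN : y ^+ 2 <= N%:R by apply: le_trans xN; rewrite xy; nra.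
have /andP[A _] := hat_row_sum_bounds (le_trans y16 yx) xN.
have /andP[_ B] := hat_row_sum_bounds y16 yN.
rewrite yE xE.
move: (\sum_(_ <= _ < _) _) (\sum_(_ <= _ < _) _) A B => SB SA A B.
have e : m%:R ^+ 2 * y ^+ 4 = x ^+ 4.
  by rewrite (_ : x ^+ 4 = (x ^+ 2) ^+ 2); [rewrite xy; ring|ring].
have m20 : 0 <= m%:R ^+ 2 :> R by rewrite sqr_ge0.
have {}B : m%:R * (m%:R * SB) <= ln 2 / 2 * x ^+ 4 - 5 / 48 * (m%:R * x ^+ 2) + 101 * (m%:R ^+ 2 * y).
  have := ler_wpM2l m20 B; rewrite -e xy => h.
  by rewrite mulrA -expr2; apply: le_trans h _; rewrite le_eqVlt; apply/orP; left; apply/eqP; ring.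
have h1 : m%:R ^+ 2 * y <= m%:R ^+ 2 * x by rewrite ler_wpM2l.
have h2 : 2 * x ^+ 2 <= m%:R * x ^+ 2 by rewrite ler_wpM2r ?sqr_ge0.
have h3 : D%:R * x <= x ^+ 2 by rewrite expr2 ler_wpM2r.
rewrite DE in h3.
move: (ln 2) A B h1 h2 h3 => l A B h1 h2 h3.
lra.
Qed.

Lemma hat_sum_diff_ge (m : nat) : (1 < m)%N -> exists K : nat, forall X N : nat, (X <= N)%N ->
  X%:Z <= 48 * ((hat_sum 1 N X)%:Z - m%:Z * (hat_sum m N X)%:Z) + K%:Z.
Proof.
move=> m1; have m0 : (0 < m)%N by lia.
pose D := (48 * (100 + 101 * m ^ 2))%N.
(* This constant dominates the deficit at each of the finitely many [X] below the threshold. *)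
exists (\sum_(0 <= X < D ^ 2) (X + 48 * (m * hat_sum m X X)))%N => X N XN.
case: (ltnP X (D ^ 2)) => XD.
  rewrite (hat_sum_stable m0 XN).
  have : (X + 48 * (m * hat_sum m X X) <= \sum_(0 <= X < D ^ 2) (X + 48 * (m * hat_sum m X X)))%N.
    by rewrite (bigD1_seq X) ?iota_uniq ?mem_index_iota //= leq_addr.
  move: (\sum_(_ <= _ < _) _)%N (hat_sum _ _ _) (hat_sum _ _ _) => S a b; lia.
apply: (@le_trans _ _ (48 * ((hat_sum 1 N X)%:Z - m%:Z * (hat_sum m N X)%:Z))); last by rewrite lerDl.
have := hat_sum_diff_ge_large Rdefinitions.R m1 XN XD.
by rewrite -(ler_int Rdefinitions.R) rmorphM rmorphB rmorphM.
Qed.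

(** * Summation by parts *)

Lemma C_hat_sum (m n : nat) : (0 < m)%N ->
  (C m n)%:Z = \sum_(0 <= M < n.+1) (hat_sum m n.+1 M.+1)%:Z * ddpart (n%:Z - M%:Z).
Proof.
move=> m0.
have -> : (C m n)%:Z = \sum_(0 <= j < n.+1) \sum_(0 <= k < j.+1)
    (string_weight j k)%:Z * part (n%:Z - (m * (j ^ 2 + j * k))%N%:Z).
  rewrite C_npart // (big_morph Posz PoszD (erefl 0%:Z)) big_mkord.
  apply: eq_bigr => j _.
  rewrite (big_morph Posz PoszD (erefl 0%:Z)).
  transitivity (\sum_(0 <= k < n.+1)
    (string_weight j k)%:Z * part (n%:Z - (m * (j ^ 2 + j * k))%N%:Z)); last first.
    rewrite (big_cat_nat (n := j.+1)) //= [X in _ + X]big1_seq ?addr0 // => k.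
    rewrite mem_index_iota => /andP[_ /andP[jk _]].
    by rewrite /string_weight [(k <= j)%N]leqNgt jk andbF mul0r.
  rewrite big_mkord; apply: eq_bigr => k _; rewrite PoszM; congr (_ * _).
  case: leqP => h; last by rewrite part_neg //; lia.
  by rewrite subzn // (@part_nat n) // leq_subr.
transitivity (\sum_(0 <= j < n.+1) \sum_(0 <= M < n.+1) \sum_(0 <= k < j.+1)
    (string_weight j k)%:Z * ((M.+1 - m * (j ^ 2 + j * k))%N%:Z * ddpart (n%:Z - M%:Z))).
  apply: eq_bigr => j _; rewrite exchange_big /=; apply: eq_bigr => k _.
  by rewrite (@part_ddpart_shift n.+1); [rewrite mulr_sumr|lia].
rewrite exchange_big /=; apply: eq_bigr => M _.
rewrite /hat_sum (big_morph Posz PoszD (erefl 0%:Z)) mulr_suml; apply: eq_bigr => j _.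
rewrite (big_morph Posz PoszD (erefl 0%:Z)) mulr_suml; apply: eq_bigr => k _.
by rewrite PoszM mulrA.
Qed.

(** At most [N ^ 2] terms, each of weight at most 2, grow by at most one unit. This crude bound
    serves only at the negative value of [ddpart]. *)
Lemma hat_sum_step (m N X : nat) : (hat_sum m N X.+1 <= hat_sum m N X + 2 * N ^ 2)%N.
Proof.
have W2 j k : (string_weight j k <= 2)%N by rewrite /string_weight; case: ifP => // _; case: ifP.
have -> : (2 * N ^ 2 = \sum_(0 <= j < N) 2 * N)%N by rewrite sum_nat_const_nat; lia.
rewrite /hat_sum -big_split /= big_nat_cond [leqRHS]big_nat_cond; apply: leq_sum => j /andP[/andP[_ jN] _].
apply: (@leq_trans (\sum_(0 <= k < j.+1) (string_weight j k * (X - m * (j ^ 2 + j * k)) + 2))).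
  by apply: leq_sum => k _; have := W2 j k; move: (m * _)%N (string_weight j k) => s w; nia.
by rewrite big_split /= sum_nat_const_nat leq_add2l; lia.
Qed.

Lemma hat_sum_homo (m N X : nat) : (hat_sum m N X <= hat_sum m N X.+1)%N.
Proof.
by apply: leq_sum => j _; apply: leq_sum => k _; rewrite leq_mul2l leq_sub2r ?orbT.
Qed.

Lemma C_diff_ge (m K n : nat) : (1 < m)%N -> (1 < n)%N ->
  (forall X N : nat, (X <= N)%N ->
    X%:Z <= 48 * ((hat_sum 1 N X)%:Z - m%:Z * (hat_sum m N X)%:Z) + K%:Z) ->
  part n%:Z - 1 - K%:Z * dpart n%:Z - (96 * m * n.+1 ^ 2)%N%:Z
  <= 48 * ((C 1 n)%:Z - m%:Z * (C m n)%:Z).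
Proof.
move=> m1 n1 hK.
have m0 : (0 < m)%N by lia.
pose g X : int := (hat_sum 1 n.+1 X)%:Z - m%:Z * (hat_sum m n.+1 X)%:Z.
have gE : (C 1 n)%:Z - m%:Z * (C m n)%:Z = \sum_(0 <= M < n.+1) g M.+1 * ddpart (n%:Z - M%:Z).
  rewrite !C_hat_sum // mulr_sumr -sumrB; apply: eq_bigr => M _; rewrite /g; ring.
have [d0 d1 _] := ddpart_small.
(* The last two terms carry [ddpart 1 = -1] and [ddpart 0 = 1]: for [g] they give [g n.+1 - g n],
   bounded by [hat_sum_step], while the other terms have nonnegative [ddpart]. *)
have split_last (F : nat -> int) : \sum_(0 <= M < n.+1) F M * ddpart (n%:Z - M%:Z)
    = \sum_(0 <= M < n.-1) F M * ddpart (n%:Z - M%:Z) - F n.-1 + F n.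
  rewrite big_nat_recr //= subrr d0 mulr1; congr (_ + _).
  case: n n1 {hK gE g} => // n n1; rewrite big_nat_recr //=.
  by rewrite (_ : n.+1%:Z - n%:Z = 1) ?d1 ?mulrN1 //; lia.
have pE : \sum_(0 <= M < n.-1) (M.+1%:Z - K%:Z) * ddpart (n%:Z - M%:Z)
   = part n%:Z - 1 - K%:Z * dpart n%:Z.
  have := split_last (fun M => M.+1%:Z - K%:Z).
  have -> : \sum_(0 <= M < n.+1) (M.+1%:Z - K%:Z) * ddpart (n%:Z - M%:Z)
     = part n%:Z - K%:Z * dpart n%:Z.
    under eq_bigr do rewrite mulrBl.
    rewrite sumrB -(@part_ddpart n.+1 n%:Z); last by lia.
    rewrite -mulr_sumr sum_ddpart.
    by rewrite [dpart (_ - _)](_ : _ = 0) ?subr0 // /dpart !part_neg //; lia.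
  by rewrite prednK; [lia|lia].
rewrite gE (split_last (fun M => g M.+1)) -pE.
have H1 : \sum_(0 <= M < n.-1) (M.+1%:Z - K%:Z) * ddpart (n%:Z - M%:Z)
   <= 48 * \sum_(0 <= M < n.-1) g M.+1 * ddpart (n%:Z - M%:Z).
  rewrite mulr_sumr; apply: ler_sum_nat => M /andP[_ Mn].
  have dd0 : 0 <= ddpart (n%:Z - M%:Z) by apply: ddpart_ge0; apply/eqP; lia.
  rewrite mulrA ler_wpM2r //.
  have Mn1 : (M.+1 <= n.+1)%N by lia.
  by have := hK _ _ Mn1; rewrite -/(g M.+1); move: (g _) => G; lia.
have H2 : - (2 * m * n.+1 ^ 2)%N%:Z <= g n.+1 - g n.
  rewrite /g; have := hat_sum_homo 1 n.+1 n; have := hat_sum_step m n.+1 n.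
  move: (hat_sum _ _ _) (hat_sum _ _ _) (hat_sum _ _ _) (hat_sum _ _ _) => a b c d; nia.
rewrite prednK; last by lia.
move: H1 H2; move: (g _) (g _) (\sum_(_ <= _ < _) _) (\sum_(_ <= _ < _) _) => *; lia.
Qed.

Local Close Scope ring_scope.

Theorem theorem1p2 (m : nat) : 2 <= m ->
  exists n0 : nat, forall n : nat, n0 <= n -> m * C m n < C 1 n.
Proof.
move=> m1; have [K hK] := hat_sum_diff_ge m1.
(* The factor makes [K * dpart n] at most half of [part n]. *)
have [n1 hn1] := @dpart_small_o (4 * K.+1) isT.
(* For [q >= Q], [q ^ 3 / 8], a lower bound for the remaining half of [part n], exceeds the
   quadratic error plus 1; 256 comes from [n.+1 <= 16 * q]. *)
pose Q := (8 * (96 * m * 256) + 9)%N.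
exists (n1 + 8 * Q)%N => n nn.
have n2 : (1 < n)%N by rewrite /Q in nn; lia.
have := C_diff_ge m1 n2 hK; have := hn1 n (ltac:(lia)).
pose q := (n %/ 8)%N.
have qn : (8 * q <= n < 8 * q + 8)%N by rewrite /q; lia.
have qQ : (Q <= q)%N by lia.
have := part_cubic q; have := @part_homo (8 * q)%N n%:Z (ltac:(lia)).
have := dpart_ge0 n%:Z.
have B1 : (96 * m * n.+1 ^ 2 <= 96 * m * 256 * q ^ 2)%N.
  have sq : (n.+1 ^ 2 <= 256 * q ^ 2)%N by nia.
  by rewrite -(mulnA (96 * m)%N) leq_mul2l sq orbT.
have B2 : (8 * (96 * m * 256 * q ^ 2) + 9 <= q ^ 3)%N.
  rewrite /Q in qQ; rewrite expnS; nia.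
move: (part (8 * q)%N%:Z) (part n%:Z) (dpart n%:Z) (C m n) (C 1 n) => a b c d e *.
nia.
Qed.
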